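(* Let $L$ be a singular Finsler metric in the generalized sense of the context on an $(n+1)$-dimensional manifold, with $L\neq0$ on its domain $D(L)$, with $(L_{\mu\nu})$ of constant rank $n-D$ ($1\le D\le n$), and with coordinates such that $\det(L_{ab})_{a,b=D+1,\dots,n}\ne0$; let $v_I^\mu(x,y)$, $I=1,\dots,D$, be linearly independent smooth null vectors as in the context. Up to $D$ arbitrary functions $\lambda^I$ ($I=1,\dots,D$), a non-linear Finsler connection of $L$ is unique: if smooth functions ${N^\mu}_\alpha(x,y)$ on $D(L)$, positively homogeneous of degree $1$ in $y$, satisfy $$\frac{\partial {N^\mu}_\alpha}{\partial y^\beta}=\frac{\partial {N^\mu}_\beta}{\partial y^\alpha},\qquad \frac{\partial L}{\partial x^\alpha}=p_\mu {N^\mu}_\alpha$$ on $D(L)$, then there are functions $\lambda^I(x,y)$, $I=1,\dots,D$, positively homogeneous of degree $2$ in $y$, such that $${N^\mu}_\alpha=\frac{\partial G^\mu}{\partial y^\alpha},\qquad G^\mu=\frac12\Big(y^\beta\frac{\partial L}{\partial x^\beta}\Big)\ell_0^\mu+\lambda^I\ell_I^\mu+\lambda^a\ell_a^\mu,$$ where $\lambda^a=L^{ab}M_b$ and $M_\mu=\frac12\Big(-\frac{\partial L}{\partial x^\mu}+y^\rho\frac{\partial^2L}{\partial y^\mu\partial x^\rho}\Big)$ (with $a,b$ running over $D+1,\dots,n$ and Greek indices over $0,\dots,n$).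
   Context: Convention: $M$ is a smooth manifold of dimension $n+1$ with local coordinates $(x^\mu)$, $\mu=0,\dots,n$ (everything is local, in one chart); the induced fibre coordinates on $TM$ (written $dx^\mu$ in the paper) are denoted $y^\mu$. Repeated indices are summed over their ranges. Finsler metric (generalized sense): a smooth real function $L(x,y)$ defined on an open subset $D(L)\subset TM\setminus\{0\}$ that is stable under $y\mapsto\lambda y$, $\lambda>0$, and satisfying $L(x,\lambda y)=\lambda L(x,y)$ for all $\lambda>0$. No convexity is assumed. Put $p_\mu=\partial L/\partial y^\mu$ and $L_{\mu\nu}=\partial^2L/\partial y^\mu\partial y^\nu$. By homogeneity $\operatorname{rank}(L_{\mu\nu})\le n$; $L$ is singular if the rank is $<n$. Null vectors: smooth functions $v_I^\mu(x,y)$ on $D(L)$, $I=1,\dots,D$, positively homogeneous of degree $0$ in $y$, pointwise linearly independent, with $L_{\mu\nu}v_I^\nu=0$ and $p_\mu v_I^\mu=0$. Notation: $\ell_0^\mu=y^\mu/L$, $\ell_I^\mu=v_I^\mu$, $\ell_a^\mu=L\,\partial\ell_0^\mu/\partial y^a=\delta_a^\mu-p_ay^\mu/L$; $(L^{ab})$ is the inverse matrix of $(L_{ab})_{a,b=D+1,\dots,n}$. *)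

(* Defs.v *)
From HB Require Import structures.
From mathcomp Require Import all_boot all_order all_algebra.
From mathcomp Require Import all_classical all_reals all_analysis.

Set Implicit Arguments.
Unset Strict Implicit.
Unset Printing Implicit Defensive.
Import Order.TTheory GRing.Theory Num.Theory.
Import numFieldNormedType.Exports.
Local Open Scope classical_set_scope.
Local Open Scope ring_scope.

(* The tangent bundle of an (n+1)-dimensional chart: a point is (x, y) with   *)
(* base coordinates x and induced fibre coordinates y.  Functions on an open  *)
(* domain are represented by total functions whose values off the domain are  *)
(* irrelevant.                                                                *)
Definition TM (R : realType) (n : nat) : normedModType R :=
  ('rV[R]_n.+1 * 'rV[R]_n.+1)%type.

Section Finsler.
Context {R : realType} {n : nat}.
Implicit Types (Dom : set (TM R n)) (f L : TM R n -> R) (mu nu : 'I_n.+1).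

Definition dx mu f : TM R n -> R := 'D_((delta_mx 0 mu, 0) : TM R n) f.

Definition dy mu f : TM R n -> R := 'D_((0, delta_mx 0 mu) : TM R n) f.

Definition ycoord mu : TM R n -> R := fun p => p.2 0 mu.

(* Since TM R n has finite dimension, f is of class C^(k+1) on an open set    *)
(* iff it is differentiable there and its derivative in every fixed direction *)
(* is of class C^k.                                                           *)
Fixpoint Ck (k : nat) Dom f : Prop :=
  if k is j.+1 then
    (forall p, Dom p -> differentiable f p) /\
    (forall v : TM R n, Ck j Dom ('D_v f))
  else forall p, Dom p -> {for p, continuous f}.

Definition smooth Dom f : Prop := forall k, Ck k Dom f.

Definition pos_homogeneous (k : nat) Dom f : Prop :=
  forall (x y : 'rV[R]_n.+1) (t : R), Dom (x, y) -> 0 < t ->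
    f (x, t *: y) = t ^+ k * f (x, y).

(* No convexity and no sign condition on L is assumed. *)
Record finsler_metric Dom L : Prop := FinslerMetric {
  finsler_open : open Dom;
  finsler_slit : forall x y : 'rV[R]_n.+1, Dom (x, y) -> y != 0;
  finsler_cone : forall (x y : 'rV[R]_n.+1) (t : R),
    Dom (x, y) -> 0 < t -> Dom (x, t *: y);
  finsler_smooth : smooth Dom L;
  finsler_homogeneous : pos_homogeneous 1 Dom L
}.

Definition momentum L mu : TM R n -> R := dy mu L.

Definition hessian L (p : TM R n) : 'M[R]_n.+1 :=
  \matrix_(mu, nu) dy mu (dy nu L) p.

Definition singular_metric Dom L : Prop :=
  forall p, Dom p -> (\rank (hessian L p) < n)%N.

Record null_vectors (d : nat) Dom L (v : 'I_d -> 'I_n.+1 -> TM R n -> R) :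
  Prop := NullVectors {
  null_smooth : forall I mu, smooth Dom (v I mu);
  null_homogeneous : forall I mu, pos_homogeneous 0 Dom (v I mu);
  null_free : forall p, Dom p -> row_free (\matrix_(I, mu) v I mu p);
  null_hessian : forall I mu p, Dom p ->
    \sum_nu hessian L p mu nu * v I nu p = 0;
  null_momentum : forall I p, Dom p ->
    \sum_mu momentum L mu p * v I mu p = 0
}.

(* The Latin index a in {d+1, ..., n} is encoded by 'I_(n - d), shifted by    *)
(* d + 1; the bound d.+1 + a < n.+1 always holds, so inord is exact.          *)
Definition latin (d : nat) (a : 'I_(n - d)) : 'I_n.+1 := inord (d.+1 + a).

Definition latin_hessian (d : nat) L (p : TM R n) : 'M[R]_(n - d) :=
  \matrix_(a, b) hessian L p (latin a) (latin b).

Definition ell0 L mu : TM R n -> R := fun p => ycoord mu p / L p.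

(* Where L p != 0 this is the Kronecker delta_nu^mu minus p_nu y^mu / L.      *)
Definition ell L (nu mu : 'I_n.+1) : TM R n -> R :=
  fun p => L p * dy nu (ell0 L mu) p.

Record nonlinear_connection Dom L (N : 'I_n.+1 -> 'I_n.+1 -> TM R n -> R) :
  Prop := NonlinearConnection {
  connection_smooth : forall mu alpha, smooth Dom (N mu alpha);
  connection_homogeneous : forall mu alpha, pos_homogeneous 1 Dom (N mu alpha);
  connection_symmetric : forall mu alpha beta p, Dom p ->
    dy beta (N mu alpha) p = dy alpha (N mu beta) p;
  connection_compatible : forall alpha p, Dom p ->
    dx alpha L p = \sum_mu momentum L mu p * N mu alpha p
}.

Definition Mform L mu : TM R n -> R := fun p =>
  2^-1 * (- dx mu L p + \sum_rho ycoord rho p * dy mu (dx rho L) p).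

Definition lambda_latin (d : nat) L (a : 'I_(n - d)) : TM R n -> R := fun p =>
  \sum_(b < n - d) invmx (latin_hessian d L p) a b * Mform L (latin b) p.

Definition spray (d : nat) L (v : 'I_d -> 'I_n.+1 -> TM R n -> R)
    (lambda : 'I_d -> TM R n -> R) mu : TM R n -> R := fun p =>
  2^-1 * (\sum_beta ycoord beta p * dx beta L p) * ell0 L mu p
  + \sum_(I < d) lambda I p * v I mu p
  + \sum_(a < n - d) lambda_latin L a p * ell L (latin a) mu p.

End Finsler.

(* Main.v *)
Require Import Defs.
From HB Require Import structures.
From mathcomp Require Import all_boot all_order all_algebra.
From mathcomp Require Import all_classical all_reals all_analysis.
From mathcomp Require Import ring.

Set Implicit Arguments.
Unset Strict Implicit.
Unset Printing Implicit Defensive.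
Import Order.TTheory GRing.Theory Num.Theory.
Import numFieldNormedType.Exports.
Local Open Scope classical_set_scope.
Local Open Scope ring_scope.

(* Put G^mu = 1/2 y^alpha N^mu_alpha. By Euler's theorem and the symmetry of
   the fibre derivatives of N, dG^mu/dy^beta = N^mu_beta, so it is enough to
   decompose G. Contracting the compatibility condition with y gives p_mu G^mu
   = 1/2 y^alpha dL/dx^alpha, and differentiating this in the fibre gives
   L_{beta mu} G^mu = M_beta. Since det (L_ab) != 0, the rows y, v_I restricted
   to the components 0, ..., d form an invertible matrix; solving G = c y +
   lambda^I v_I in these components by Cramer's rule makes lambda smooth. The
   remainder lives in the Latin components and, y and v_I being annihilated by
   the Hessian, equals L^{ab} M_b there. Contracting with p determines c. *)

(** Differentiability is local: the first-order expansion of [f] at [a] serves for [g] too, and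
    [diff_unique] identifies its linear part with ['d g a]. *)
Lemma near_eq_differentiable (R : realType) (V W : normedModType R)
    (f g : V -> W) (a : V) :
  (\near a, f a = g a) -> differentiable f a -> differentiable g a.
Proof.
move=> fg df.
have fga := nbhs_singleton fg.
have fg0 : \forall h \near 0, f (h + a) = g (h + a).
  by move: fg; rewrite (near_shift 0) subr0.
have [dfc /eqaddoP fo] := (diff_locallyP a f).1 df.
have go : g \o shift a = cst (g a) + 'd f a +o_ 0 id.
  apply/eqaddoP => e e0; near=> h.
  have -> : (g \o shift a - (cst (g a) + 'd f a)) h
      = (f \o shift a - (cst (f a) + 'd f a)) h.
    rewrite /= !fctE /= fga; congr (_ - _); apply/esym.
    by near: h.
  by near: h; exact: fo.
have gE := diff_unique dfc go.
by apply/diff_locallyP; rewrite gE.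
Unshelve. all: by end_near. Qed.

(** * Calculus of smooth functions on an open set and Euler's theorem *)

Section SmoothCalculus.
Context {R : realType} {n : nat} (Dom : set (TM R n)).
Hypothesis Dom_open : open Dom.
Implicit Types (f g : TM R n -> R) (k : nat) (w p : TM R n).

Lemma near_eq_open f g p :
  (forall q, Dom q -> f q = g q) -> Dom p -> \near p, f p = g p.
Proof. by move=> fg Dp; apply: filterS fg _; exact: open_nbhs_nbhs. Qed.

Lemma eq_derive_open f g w p : (forall q, Dom q -> f q = g q) -> Dom p ->
  'D_w f p = 'D_w g p.
Proof. by move=> fg Dp; apply/near_eq_derive/near_eq_open. Qed.

(** Rules for ['D_w] give equalities on [Dom] only; since [Dom] is open, these pass to all
    derivatives. *)
Lemma eq_Ck k f g : (forall q, Dom q -> f q = g q) -> Ck k Dom f -> Ck k Dom g.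
Proof.
elim: k f g => [|k IH] f g fg /=.
  move=> fc p Dp; have fga := near_eq_open fg Dp.
  rewrite /prop_for /continuous_at -(fg _ Dp); apply: cvg_trans (fc _ Dp).
  exact: near_eq_cvg.
move=> [fd fD]; split=> [p Dp|w].
  exact: near_eq_differentiable (near_eq_open fg Dp) (fd _ Dp).
by apply: IH (fD w) => q; exact: eq_derive_open.
Qed.

Lemma CkW k f : Ck k.+1 Dom f -> Ck k Dom f.
Proof.
elim: k f => [|k IH] f [fd fD].
  by move=> p Dp; exact/differentiable_continuous/fd.
by split=> // w; apply/IH/fD.
Qed.

Lemma Ck_cst k (c : R) : Ck k Dom (fun=> c).
Proof.
elim: k c => [|k IH] c /=; first by move=> p _; exact: cst_continuous.
split=> [p _|w]; first exact: differentiable_cst.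
by apply: eq_Ck (IH 0) => q _; rewrite derive_cst.
Qed.

Lemma CkD k f g : Ck k Dom f -> Ck k Dom g -> Ck k Dom (fun p => f p + g p).
Proof.
elim: k f g => [|k IH] f g /=.
  by move=> fc gc p Dp; exact: continuousD (fc _ Dp) (gc _ Dp).
move=> [fd fD] [gd gD]; split=> [p Dp|w].
  exact: differentiableD (fd _ Dp) (gd _ Dp).
apply: eq_Ck (IH _ _ (fD w) (gD w)) => q Dq.
by rewrite (@deriveD _ _ _ f g)//; apply/diff_derivable; [exact: fd|exact: gd].
Qed.

Lemma CkM k f g : Ck k Dom f -> Ck k Dom g -> Ck k Dom (fun p => f p * g p).
Proof.
elim: k f g => [|k IH] f g.
  by move=> fc gc p Dp; exact: continuousM (fc _ Dp) (gc _ Dp).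
move=> fk gk; have [[fd fD] [gd gD]] := (fk, gk); split=> [p Dp|w].
  exact: differentiableM (fd _ Dp) (gd _ Dp).
(* The product rule keeps undifferentiated factors, which [CkW] lowers to order [k]. *)
apply: eq_Ck (CkD (IH _ _ (CkW fk) (gD w)) (IH _ _ (CkW gk) (fD w))) => q Dq.
by rewrite (@deriveM _ _ f g)//; apply/diff_derivable; [exact: fd|exact: gd].
Qed.

Lemma CkV k f : (forall p, Dom p -> f p != 0) -> Ck k Dom f ->
  Ck k Dom (fun p => (f p)^-1).
Proof.
move=> f0; elim: k => [|k IH].
  by move=> fc p Dp; exact: continuousV (f0 _ Dp) (fc _ Dp).
move=> fk; have [fd fD] := fk; split=> [p Dp|w].
  exact: differentiableV (fd _ Dp) (f0 _ Dp).
have fV := IH (CkW fk).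
(* The derivative of [f^-1] is [- f^-2 * 'D_w f], and [f^-1] is of class [k] by induction. *)
apply: eq_Ck (CkM (CkM (Ck_cst k (-1)) (CkM fV fV)) (fD w)) => q Dq.
rewrite deriveV ?f0//; last exact/diff_derivable/fd.
by rewrite mulN1r -expr2 exprVn.
Qed.

Lemma smooth_differentiable {f p} : smooth Dom f -> Dom p -> differentiable f p.
Proof. by move=> /(_ 1%N)[fd _]; exact: fd. Qed.

Lemma smooth_derivable {f w p} : smooth Dom f -> Dom p -> derivable f p w.
Proof. by move=> fs Dp; exact/diff_derivable/smooth_differentiable. Qed.

Lemma smooth_derive w f : smooth Dom f -> smooth Dom ('D_w f).
Proof. by move=> fs k; have [_] := fs k.+1; exact. Qed.

Lemma smoothD f g : smooth Dom f -> smooth Dom g ->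
  smooth Dom (fun p => f p + g p).
Proof. by move=> fs gs k; exact: CkD. Qed.

Lemma smoothM f g : smooth Dom f -> smooth Dom g ->
  smooth Dom (fun p => f p * g p).
Proof. by move=> fs gs k; exact: CkM. Qed.

Lemma smoothV f : (forall p, Dom p -> f p != 0) -> smooth Dom f ->
  smooth Dom (fun p => (f p)^-1).
Proof. by move=> f0 fs k; exact: CkV. Qed.

Lemma smooth_cst (c : R) : smooth Dom (fun=> c).
Proof. by move=> k; exact: Ck_cst. Qed.

Lemma smooth_sum I (r : seq I) (F : I -> TM R n -> R) :
  (forall i, smooth Dom (F i)) -> smooth Dom (fun p => \sum_(i <- r) F i p).
Proof.
move=> Fs; elim: r => [|i r IH] k.
  by apply: eq_Ck (smooth_cst 0 k) => q _; rewrite big_nil.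
by apply: eq_Ck (smoothD (Fs i) IH k) => q _; rewrite big_cons.
Qed.

Lemma smooth_prod I (r : seq I) (F : I -> TM R n -> R) :
  (forall i, smooth Dom (F i)) -> smooth Dom (fun p => \prod_(i <- r) F i p).
Proof.
move=> Fs; elim: r => [|i r IH] k.
  by apply: eq_Ck (smooth_cst 1 k) => q _; rewrite big_nil.
by apply: eq_Ck (smoothM (Fs i) IH k) => q _; rewrite big_cons.
Qed.

Lemma smooth_det m (A : TM R n -> 'M[R]_m) :
  (forall i j, smooth Dom (fun p => A p i j)) ->
  smooth Dom (fun p => \det (A p)).
Proof.
move=> As; apply: smooth_sum => s; apply: smoothM (smooth_cst _) _.
by apply: smooth_prod => i; exact: As.
Qed.

(** Cramer's rule: each entry is a cofactor over the determinant. This formula for [invmx] requires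
    [A p] to be a unit, hence is used on [Dom] only. *)
Lemma smooth_invmx m (A : TM R n -> 'M[R]_m) :
  (forall p, Dom p -> A p \in unitmx) ->
  (forall i j, smooth Dom (fun p => A p i j)) ->
  forall i j, smooth Dom (fun p => invmx (A p) i j).
Proof.
move=> Au As i j k.
have A0 p : Dom p -> \det (A p) != 0 by move=> /Au; rewrite unitmxE unitfE.
suff As' : smooth Dom (fun p => (\det (A p))^-1 * cofactor (A p) j i).
  by apply: eq_Ck (As' k) => q Dq; rewrite /invmx (Au _ Dq) !mxE.
apply: smoothM; first by apply: smoothV => //; exact: smooth_det.
apply: smoothM (smooth_cst _) _; apply: smooth_det => i' j' k'.
by apply: eq_Ck (As (lift j i') (lift i j') k') => q _; rewrite !mxE.
Qed.

Lemma differentiable_ycoord mu p : differentiable (ycoord mu : TM R n -> R) p.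
Proof.
apply: (@differentiable_comp _ _ _ _ snd (fun y : 'rV[R]_n.+1 => y 0 mu)).
  apply: (@linear_differentiable _ _ _ (snd : {linear _ -> _})) => q.
  exact: cvg_snd.
exact: differentiable_coord.
Qed.

Lemma derive_ycoord w mu p : 'D_w (ycoord mu) p = w.2 0 mu.
Proof.
rewrite /derive; apply: lim_near_cst => //; near=> h.
rewrite /= /ycoord /= !mxE addrK /GRing.scale /= mulKf//.
by near: h; exact: nbhs_dnbhs_neq.
Unshelve. all: by end_near. Qed.

Lemma dy_ycoord mu nu p : dy nu (ycoord mu) p = (mu == nu)%:R.
Proof. by rewrite /dy derive_ycoord mxE eqxx. Qed.

Lemma smooth_ycoord mu : smooth Dom (ycoord mu).
Proof.
move=> [|k].
  by move=> p _; exact/differentiable_continuous/differentiable_ycoord.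
split=> [p _|w]; first exact: differentiable_ycoord.
by apply: eq_Ck (smooth_cst (w.2 0 mu) k) => q _; rewrite derive_ycoord.
Qed.

Lemma derive_sumM m (f g : 'I_m -> TM R n -> R) w p :
  (forall i, smooth Dom (f i)) -> (forall i, smooth Dom (g i)) -> Dom p ->
  'D_w (fun q => \sum_i f i q * g i q) p
  = \sum_i ('D_w (f i) p * g i p + f i p * 'D_w (g i) p).
Proof.
move=> fs gs Dp.
have -> : (fun q => \sum_i f i q * g i q) = \sum_i (f i * g i).
  by apply/funext => q; rewrite fct_sumE.
rewrite derive_sum => [|i]; last first.
  by apply: derivableM; exact: smooth_derivable.
apply: eq_bigr => i _; rewrite deriveM; try exact: smooth_derivable.
by rewrite addrC mulrC.
Qed.

(** On the ray through [y] the function is [t ^+ k * f (x, y)], to be differentiated at [t = 1]. *)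
Lemma derive_radial k f x y : pos_homogeneous k Dom f -> Dom (x, y) ->
  'D_((0, y) : TM R n) f (x, y) = k%:R * f (x, y).
Proof.
move=> fk Dp.
have -> : k%:R * f (x, y) = 'D_1 (fun t : R => t ^+ k * f (x, y)) 1.
  rewrite -[fun _ => _]/(f (x, y) \o* (fun t : R => t ^+ k)).
  rewrite deriveMr; last exact: exprn_derivable.
  rewrite mulrC; congr (_ * _); case: k {fk} => [|k].
    by rewrite (_ : (fun t : R => t ^+ 0) = cst 1) ?derive_cst// funeqE.
  by rewrite exp_derive expr1n /GRing.scale /= !mulr1.
(* The form [h * 1 + 1] is that of the difference quotient at 1 in direction 1; the factor is
   positive as soon as [|h| < 1]. *)
have fE : \forall h \near (0 : R)^',
    f (h *: ((0, y) : TM R n) + (x, y)) = (h * 1 + 1) ^+ k * f (x, y).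
  near=> h; have h1 : 0 < h * 1 + 1.
    rewrite mulr1 -ltrBlDr sub0r; apply: ltrNnormlW.
    by near: h; exact: dnbhs0_lt.
  rewrite -(fk _ _ _ Dp h1); congr f; apply/pair_equal_spec; split=> /=.
    by rewrite scaler0 add0r.
  by rewrite mulr1 scalerDl scale1r.
rewrite /derive; congr (lim _).
rewrite eqEsubset; split; apply: near_eq_cvg; apply: filterS fE => h /= ->;
  by rewrite expr1n mul1r.
Unshelve. all: by end_near. Qed.

(** Differentiability makes the derivative linear in its direction, so the radial derivative splits
    along the fibre coordinates. *)
Lemma euler_homogeneous k f p : pos_homogeneous k Dom f -> Dom p ->
  differentiable f p -> \sum_mu dy mu f p * ycoord mu p = k%:R * f p.
Proof.
case: p => x y fk Dp fd; rewrite -(derive_radial fk Dp) deriveE//.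
have -> : ((0, y) : TM R n) = \sum_mu y 0 mu *: ((0, delta_mx 0 mu) : TM R n).
  rewrite {1}[y]row_sum_delta.
  rewrite (big_morph (pair 0 : _ -> TM R n) (id1 := 0) (op1 := +%R))//.
    apply: eq_bigr => mu _; apply/pair_equal_spec; split=> //=.
    by rewrite scaler0.
  by move=> a b; apply/pair_equal_spec; rewrite /= addr0.
rewrite linear_sum; apply: eq_bigr => mu _.
by rewrite linearZ /dy deriveE// mulrC.
Qed.

End SmoothCalculus.

(** Turns a single component into a sum over all indices, which [sum_nonlatin_latin] can then
    split. *)
Lemma delta_sum (R : pzSemiRingType) (I : finType) (w : I -> R) i :
  w i = \sum_j w j * (i == j)%:R.
Proof.
rewrite (bigD1 i)//= eqxx mulr1 big1 ?addr0// => j ji.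
by rewrite eq_sym (negbTE ji) mulr0.
Qed.

(** * Splitting the indices into 0, ..., d and the Latin ones *)

Section Indices.
Context {n d : nat} (hd : (d <= n)%N).

(* The indices 0, ..., d; inord is exact only because d <= n. *)
Definition nonlatin (j : 'I_d.+1) : 'I_n.+1 := inord j.

Lemma sum_nonlatin_latin (V : nmodType) (F : 'I_n.+1 -> V) :
  \sum_mu F mu = \sum_j F (nonlatin j) + \sum_(a < n - d) F (latin a).
Proof.
have -> : \sum_mu F mu = \sum_(0 <= i < n.+1) F (inord i).
  by rewrite big_mkord; apply: eq_bigr => mu _; rewrite inord_val.
rewrite (big_cat_nat (n := d.+1))//= big_mkord; congr (_ + _).
(* The shift by [d.+1] leaves [n.+1 - d.+1 = n - d] terms, the range of the Latin index. *)
rewrite -{1}[d.+1]add0n big_addn subSS big_mkord.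
by apply: eq_bigr => a _; rewrite addnC.
Qed.

End Indices.

(** * Euler identities for the metric and the potential of a connection *)

Section Connection.
Context {R : realType} {n : nat} (Dom : set (TM R n)).
Context (L : TM R n -> R) (N : 'I_n.+1 -> 'I_n.+1 -> TM R n -> R).
Hypothesis hL : finsler_metric Dom L.
Hypothesis hL0 : forall p, Dom p -> L p != 0.
Hypothesis hN : nonlinear_connection Dom L N.

Let Dom_open := finsler_open hL.
Let L_smooth := finsler_smooth hL.
Let N_smooth := connection_smooth hN.

Lemma momentum_smooth mu : smooth Dom (momentum L mu).
Proof. exact: smooth_derive. Qed.

Lemma momentum_ycoord p : Dom p -> \sum_mu momentum L mu p * ycoord mu p = L p.
Proof.
move=> Dp; rewrite (euler_homogeneous (finsler_homogeneous hL) Dp) ?mul1r//.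
exact: smooth_differentiable.
Qed.

(** Differentiating [momentum_ycoord] in the fibre gives [L_{mu nu} y^nu + p_mu = p_mu]. *)
Lemma hessian_ycoord mu p : Dom p ->
  \sum_nu hessian L p mu nu * ycoord nu p = 0.
Proof.
move=> Dp.
have := eq_derive_open Dom_open (0, delta_mx 0 mu) momentum_ycoord Dp.
rewrite (@derive_sumM _ _ Dom)//; first last.
- by move=> nu; exact: smooth_ycoord.
- exact: momentum_smooth.
rewrite big_split /= [X in _ + X = _](_ : _ = momentum L mu p); last first.
  rewrite (bigD1 mu)//= -/(dy mu _ p) dy_ycoord eqxx mulr1.
  rewrite big1 ?addr0// => nu nm.
  by rewrite -/(dy mu _ p) dy_ycoord (negbTE nm) mulr0.
move=> /(canRL (addrK _)); rewrite subrr => E; rewrite -[RHS]E.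
by apply: eq_bigr => nu _; rewrite mxE.
Qed.

Lemma ellE nu mu p : Dom p ->
  ell L nu mu p = (mu == nu)%:R - momentum L nu p * ycoord mu p / L p.
Proof.
move=> Dp; have L0 := hL0 Dp; rewrite /ell /dy /ell0.
have Ld w : derivable L p w by exact: smooth_derivable.
have LVd w : derivable (fun q => (L q)^-1) p w.
  exact: (@derivableV _ _ L).
have yd w : derivable (ycoord mu : TM R n -> R) p w.
  exact/diff_derivable/differentiable_ycoord.
rewrite (@deriveM _ _ (ycoord mu : TM R n -> R) (fun q => (L q)^-1))//.
rewrite (@deriveV _ _ L)// -/(dy nu (ycoord mu) p) dy_ycoord.
rewrite -/(dy nu L p) -/(momentum L nu p).
rewrite /GRing.scale /=; by field; exact: L0.
Qed.

Definition potential mu : TM R n -> R := fun p =>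
  2^-1 * \sum_alpha ycoord alpha p * N mu alpha p.

Lemma potential_smooth mu : smooth Dom (potential mu).
Proof.
apply: smoothM => //; first exact: smooth_cst.
by apply: smooth_sum => // alpha; apply: smoothM => //; exact: smooth_ycoord.
Qed.

Lemma potential_homogeneous mu : pos_homogeneous 2 Dom (potential mu).
Proof.
move=> x y t Dp t0; rewrite /potential mulrCA; congr (_ * _).
rewrite mulr_sumr; apply: eq_bigr => alpha _.
rewrite (connection_homogeneous hN _ _ Dp t0) /ycoord /= mxE; ring.
Qed.

Lemma dy_potential mu beta p : Dom p -> dy beta (potential mu) p = N mu beta p.
Proof.
move=> Dp; have Nd alpha := smooth_differentiable (N_smooth mu alpha) Dp.
rewrite /dy /potential.
have -> : (fun q => 2^-1 * \sum_alpha ycoord alpha q * N mu alpha q)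
  = (2^-1 \o* (fun q => \sum_alpha ycoord alpha q * N mu alpha q)).
  by apply/funext => q /=; rewrite mulrC.
rewrite deriveMr; last first.
  apply: (@smooth_derivable _ _ Dom) => //; apply: smooth_sum => // alpha.
  by apply: smoothM => //; exact: smooth_ycoord.
rewrite (@derive_sumM _ _ Dom)//; last by move=> alpha; exact: smooth_ycoord.
rewrite big_split /= (bigD1 beta)//= -/(dy beta _ p) dy_ycoord eqxx mul1r.
rewrite big1 ?addr0 => [|alpha nb]; last first.
  by rewrite -/(dy beta _ p) dy_ycoord (negbTE nb) mul0r.
(* Symmetry turns the remaining sum into the Euler sum of [N mu beta], of degree 1; the two equal
   contributions absorb the factor [2^-1]. *)
have := euler_homogeneous (connection_homogeneous hN mu beta) Dp (Nd beta).
rewrite mul1r (eq_bigr (fun alpha => ycoord alpha p * dy beta (N mu alpha) p)).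
  by move=> ->; field.
by move=> alpha _; rewrite (connection_symmetric hN _ _ _ Dp) mulrC.
Qed.

Lemma momentum_potential p : Dom p ->
  \sum_mu momentum L mu p * potential mu p
  = 2^-1 * \sum_alpha ycoord alpha p * dx alpha L p.
Proof.
move=> Dp; rewrite (eq_bigr (fun mu => \sum_alpha
  2^-1 * (ycoord alpha p * (momentum L mu p * N mu alpha p)))); last first.
  move=> mu _; rewrite /potential !mulr_sumr.
  by apply: eq_bigr => alpha _; ring.
rewrite exchange_big mulr_sumr; apply: eq_bigr => alpha _.
by rewrite -!mulr_sumr (connection_compatible hN _ Dp).
Qed.

(* Differentiate [momentum_potential] in the fibre: the terms in which the
   derivative falls on the potential give p_mu N^mu_beta = dL/dx^beta. *)
Lemma hessian_potential beta p : Dom p ->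
  \sum_nu hessian L p beta nu * potential nu p = Mform L beta p.
Proof.
move=> Dp.
have := eq_derive_open Dom_open (0, delta_mx 0 beta) momentum_potential Dp.
have xL_smooth alpha : smooth Dom (dx alpha L) by exact: smooth_derive.
rewrite (@derive_sumM _ _ Dom)//; first last.
- exact: potential_smooth.
- exact: momentum_smooth.
have -> : (fun q => 2^-1 * \sum_alpha ycoord alpha q * dx alpha L q)
  = (2^-1 \o* (fun q => \sum_alpha ycoord alpha q * dx alpha L q)).
  by apply/funext => q /=; rewrite mulrC.
rewrite deriveMr; last first.
  apply: (@smooth_derivable _ _ Dom) => //; apply: smooth_sum => // alpha.
  by apply: smoothM => //; exact: smooth_ycoord.
rewrite (@derive_sumM _ _ Dom)//; last by move=> alpha; exact: smooth_ycoord.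
rewrite !big_split /= [X in _ + X = _](_ : _ = dx beta L p); last first.
  rewrite (connection_compatible hN _ Dp); apply: eq_bigr => mu _.
  by rewrite -/(dy beta _ p) dy_potential.
rewrite [X in _ = _ * (X + _)](_ : _ = dx beta L p); last first.
  rewrite (bigD1 beta)//= -/(dy beta _ p) dy_ycoord eqxx mul1r.
  rewrite big1 ?addr0// => alpha nb.
  by rewrite -/(dy beta _ p) dy_ycoord (negbTE nb) mul0r.
(* Moving [dx beta L p] across leaves [2^-1 - 1] times it, whence the minus sign in [Mform]. *)
move=> /(canRL (addrK _)) E; rewrite /Mform.
transitivity
  (\sum_mu 'D_(0, delta_mx 0 beta) (momentum L mu) p * potential mu p).
  by apply: eq_bigr => nu _; rewrite mxE.
by rewrite E /dy; field.
Qed.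

End Connection.

(** * Frame of the Hessian kernel and decomposition of the potential *)

Section Frame.
Context {R : realType} {n d : nat} (Dom : set (TM R n)) (L : TM R n -> R).
Context (v : 'I_d -> 'I_n.+1 -> TM R n -> R).
Hypothesis hd : (d <= n)%N.
Hypothesis hL : finsler_metric Dom L.
Hypothesis hL0 : forall p, Dom p -> L p != 0.
Hypothesis hdet : forall p, Dom p -> \det (latin_hessian d L p) != 0.
Hypothesis hv : null_vectors Dom L v.

(** On a vector with only Latin components, the Latin rows of the Hessian act through the invertible
    block [L_ab]. With [m = 0] this serves the independence of the frame, with [m = M] the
    computation of the remainder. *)
Lemma latin_solve p (w : 'I_n.+1 -> R) (m : 'I_(n - d) -> R) : Dom p ->
  (forall j : 'I_d.+1, w (nonlatin j) = 0) ->
  (forall a, \sum_nu hessian L p (latin a) nu * w nu = m a) ->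
  forall a, w (latin a) = \sum_b invmx (latin_hessian d L p) a b * m b.
Proof.
move=> Dp w0 Hw a.
have HE : latin_hessian d L p *m (\col_b w (latin b)) = \col_b m b.
  apply/colP => b; rewrite !mxE -Hw (sum_nonlatin_latin hd).
  rewrite [X in _ = X + _]big1 ?add0r => [|j _]; last by rewrite w0 mulr0.
  by apply: eq_bigr => c _; rewrite !mxE.
have Hu : latin_hessian d L p \in unitmx by rewrite unitmxE unitfE hdet.
have := congr1 (mulmx (invmx (latin_hessian d L p))) HE.
rewrite mulKmx// => /colP /(_ a); rewrite !mxE => ->.
by apply: eq_bigr => b _; rewrite !mxE.
Qed.

(* The kernel of the Hessian is spanned by the fibre coordinate vector and the
   null vectors. *)
Definition frame (i : 'I_d.+1) (mu : 'I_n.+1) : TM R n -> R :=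
  if unlift ord0 i is Some J then v J mu else ycoord mu.

Lemma frame0 mu : frame ord0 mu = ycoord mu.
Proof. by rewrite /frame unlift_none. Qed.

Lemma frame_lift I mu : frame (lift ord0 I) mu = v I mu.
Proof. by rewrite /frame liftK. Qed.

Lemma frame_smooth i mu : smooth Dom (frame i mu).
Proof.
have Dom_open := finsler_open hL.
rewrite /frame; case: unliftP => [I _|_]; first exact: null_smooth hv I mu.
exact: smooth_ycoord.
Qed.

Lemma hessian_frame i mu p : Dom p ->
  \sum_nu hessian L p mu nu * frame i nu p = 0.
Proof.
move=> Dp; rewrite /frame; case: unliftP => [I _|_].
  exact: null_hessian hv I mu p Dp.
exact: hessian_ycoord hL mu p Dp.
Qed.

(** Contraction with [p] isolates the coefficient of [y], because [p_mu v_I^mu = 0] and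
    [p_mu y^mu = L]. *)
Lemma momentum_frame (c : 'I_d.+1 -> R) p : Dom p ->
  \sum_mu momentum L mu p * (\sum_i c i * frame i mu p) = c ord0 * L p.
Proof.
move=> Dp; transitivity (\sum_i c i * \sum_mu momentum L mu p * frame i mu p).
  under eq_bigr do rewrite mulr_sumr.
  rewrite exchange_big; apply: eq_bigr => i _.
  by rewrite mulr_sumr; apply: eq_bigr => mu _; rewrite mulrCA.
rewrite big_ord_recl [X in _ + X]big1 ?addr0 => [|I _].
  by under eq_bigr do rewrite frame0; rewrite (momentum_ycoord hL Dp).
by under eq_bigr do rewrite frame_lift; rewrite (null_momentum hv _ Dp) mulr0.
Qed.

Lemma hessian_frame_sum (c : 'I_d.+1 -> R) mu p : Dom p ->
  \sum_nu hessian L p mu nu * (\sum_i c i * frame i nu p) = 0.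
Proof.
move=> Dp; under eq_bigr do rewrite mulr_sumr.
rewrite exchange_big big1// => i _.
under eq_bigr do rewrite mulrCA.
by rewrite -mulr_sumr hessian_frame ?mulr0.
Qed.

Definition frame_mx p : 'M[R]_d.+1 := \matrix_(i, j) frame i (nonlatin j) p.

(* A combination of the frame with vanishing non-Latin components is
   annihilated by the Hessian, so its Latin components vanish as well. *)
Lemma frame_mx_unit p : Dom p -> frame_mx p \in unitmx.
Proof.
move=> Dp; rewrite -row_free_unit; apply: inj_row_free => u u0.
pose w mu := \sum_i u 0 i * frame i mu p.
have wg (j : 'I_d.+1) : w (nonlatin j) = 0.
  move/rowP: u0 => /(_ j); rewrite !mxE => <-.
  by apply: eq_bigr => i _; rewrite !mxE.
have wl (a : 'I_(n - d)) : w (latin a) = 0.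
  rewrite (latin_solve (m := fun=> 0) Dp wg) => [|b].
    by rewrite big1// => b _; rewrite mulr0.
  exact: hessian_frame_sum.
have w0 mu : w mu = 0.
  rewrite (delta_sum w) (sum_nonlatin_latin hd) !big1 ?addr0// => i _.
    by rewrite wl mul0r.
  by rewrite wg mul0r.
(* Contracting with the momentum leaves [u 0 ord0 * L p], where [L p != 0]; the rest is a vanishing
   combination of the independent null vectors. *)
have u00 : u 0 ord0 = 0.
  have := momentum_frame (u 0) Dp.
  under eq_bigr do rewrite -/(w _) w0 mulr0.
  rewrite big1// => /esym/eqP; rewrite mulf_eq0 (negbTE (hL0 Dp)) orbF.
  by move=> /eqP.
have ul : \row_I u 0 (lift ord0 I) = 0.
  apply: (row_free_inj (null_free hv Dp)); rewrite mul0mx; apply/rowP => mu.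
  rewrite !mxE; apply: etrans (w0 mu); rewrite /w big_ord_recl u00 mul0r add0r.
  by apply: eq_bigr => I _; rewrite !mxE frame_lift.
apply/rowP => i; rewrite mxE; case: (unliftP ord0 i) => [I|] -> //.
by move/rowP: ul => /(_ I); rewrite !mxE.
Qed.

Context (N : 'I_n.+1 -> 'I_n.+1 -> TM R n -> R).
Hypothesis hN : nonlinear_connection Dom L N.

(** The non-Latin components alone fix these coordinates. The one at [ord0] is the coefficient of
    [y]; those at [lift ord0 I] are the desired [lambda^I]. *)
Definition frame_coord i : TM R n -> R := fun p =>
  ((\row_j potential N (nonlatin j) p) *m invmx (frame_mx p)) 0 i.

Lemma frame_coord_smooth i : smooth Dom (frame_coord i).
Proof.
have Dom_open := finsler_open hL.
move=> k; suff s : smooth Dom (fun p =>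
    \sum_(j < d.+1) potential N (nonlatin j) p * invmx (frame_mx p) j i).
  by apply: (eq_Ck Dom_open) (s k) => p _; rewrite /frame_coord !mxE;
    apply: eq_bigr => j _; rewrite !mxE.
apply: smooth_sum => // j; apply: smoothM => //.
  exact: potential_smooth hL hN _.
apply: smooth_invmx => // [p|i' j' k']; first exact: frame_mx_unit.
apply: (eq_Ck Dom_open) (frame_smooth i' (nonlatin j') k') => p _.
by rewrite mxE.
Qed.

Lemma frame_coordE (j : 'I_d.+1) p : Dom p ->
  potential N (nonlatin j) p = \sum_i frame_coord i p * frame i (nonlatin j) p.
Proof.
move=> Dp.
have := mulmxKV (frame_mx_unit Dp) (\row_(j < d.+1) potential N (nonlatin j) p).
move=> /rowP /(_ j); rewrite !mxE => <-.
by apply: eq_bigr => i _; rewrite [X in _ * X]mxE.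
Qed.

(* The potential has degree 2, the null vectors degree 0 and the fibre
   coordinate vector degree 1: uniqueness of the coordinates concludes. *)
Lemma frame_coord_homogeneous I :
  pos_homogeneous 2 Dom (frame_coord (lift ord0 I)).
Proof.
move=> x y t Dp t0; have Dq := finsler_cone hL Dp t0.
(* Expected coordinates at the scaled point: of the total factor [t ^+ 2], the vector [y] supplies
   one [t] itself and the null vectors none. *)
pose s : 'rV[R]_d.+1 := \row_i
  ((if i == ord0 then t else t ^+ 2) * frame_coord i (x, y)).
have E : \row_(j < d.+1) potential N (nonlatin j) (x, t *: y)
    = s *m frame_mx (x, t *: y).
  apply/rowP => j; rewrite !mxE (potential_homogeneous hN _ Dp t0).
  rewrite frame_coordE// mulr_sumr; apply: eq_bigr => i _; rewrite !mxE /frame.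
  case: unliftP => [J ->|->] /=.
    by rewrite (null_homogeneous hv _ _ Dp t0) expr0 mul1r mulrA.
  by rewrite /ycoord /= mxE; ring.
by rewrite /frame_coord E mulmxK ?frame_mx_unit// mxE.
Qed.

Lemma potential_decomposition mu p : Dom p -> potential N mu p =
  \sum_i frame_coord i p * frame i mu p
  + \sum_(a < n - d) lambda_latin L a p * (mu == latin a)%:R.
Proof.
move=> Dp.
pose w nu := potential N nu p - \sum_i frame_coord i p * frame i nu p.
have wg (j : 'I_d.+1) : w (nonlatin j) = 0 by rewrite /w frame_coordE// subrr.
(* The Hessian kills the frame part, so it sends [w] to [Mform]. *)
have wl (a : 'I_(n - d)) : w (latin a) = lambda_latin L a p.
  apply: (latin_solve (m := fun b => Mform L (latin b) p) Dp wg) => b.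
  under eq_bigr do rewrite mulrBr.
  by rewrite sumrB (hessian_potential hL hN _ Dp) hessian_frame_sum// subr0.
apply/eqP; rewrite addrC -subr_eq -/(w mu); apply/eqP.
rewrite (delta_sum w) (sum_nonlatin_latin hd) big1 ?add0r => [|j _].
  by apply: eq_bigr => a _; rewrite wl.
by rewrite wg mul0r.
Qed.

(** With [c] the coefficient of [y], contracting the decomposition with [p] gives [1/2 y^beta
    dL/dx^beta = c L + lambda^a p_a]. Each [ell_a] differs from a coordinate vector by
    [- p_a y / L], so the multiples of [y] in the spray add up to [c y]. *)
Lemma spray_potential mu p : Dom p ->
  spray L v (fun I => frame_coord (lift ord0 I)) mu p = potential N mu p.
Proof.
move=> Dp; have L0 := hL0 Dp.
have := momentum_potential hN Dp.
under eq_bigr do rewrite potential_decomposition// mulrDr.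
rewrite big_split /= momentum_frame//.
have -> : \sum_mu momentum L mu p
      * (\sum_(a < n - d) lambda_latin L a p * (mu == latin a)%:R)
    = \sum_(a < n - d) lambda_latin L a p * momentum L (latin a) p.
  under eq_bigr do rewrite mulr_sumr.
  rewrite exchange_big; apply: eq_bigr => a _.
  rewrite (bigD1 (latin a))//= eqxx mulr1 mulrC big1 ?addr0// => nu nm.
  by rewrite (negbTE nm) !mulr0.
rewrite /spray potential_decomposition// [X in _ = X + _]big_ord_recl.
rewrite frame0 /ell0 => <-.
have -> : \sum_(a < n - d) lambda_latin L a p * ell L (latin a) mu p =
    \sum_(a < n - d) lambda_latin L a p * (mu == latin a)%:R
    - (\sum_(a < n - d) lambda_latin L a p * momentum L (latin a) p)
      * (ycoord mu p / L p).
  rewrite mulr_suml -sumrB; apply: eq_bigr => a _.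
  by rewrite (ellE hL)// mulrBr !mulrA.
have -> : \sum_(I < d) frame_coord (lift ord0 I) p * frame (lift ord0 I) mu p
    = \sum_(I < d) frame_coord (lift ord0 I) p * v I mu p.
  by apply: eq_bigr => I _; rewrite frame_lift.
by field; exact: L0.
Qed.

End Frame.

Theorem mainTheorem4 (R : realType) (n d : nat)
    (Dom : set (TM R n)) (L : TM R n -> R)
    (v : 'I_d -> 'I_n.+1 -> TM R n -> R)
    (N : 'I_n.+1 -> 'I_n.+1 -> TM R n -> R)
    (hd : (1 <= d <= n)%N)
    (hL : finsler_metric Dom L)
    (hsing : singular_metric Dom L)
    (hL0 : forall p, Dom p -> L p != 0)
    (hrank : forall p, Dom p -> \rank (hessian L p) = (n - d)%N)
    (hdet : forall p, Dom p -> \det (latin_hessian d L p) != 0)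
    (hv : null_vectors Dom L v)
    (hN : nonlinear_connection Dom L N) :
  exists lambda : 'I_d -> TM R n -> R,
    (forall I, smooth Dom (lambda I)) /\
    (forall I, pos_homogeneous 2 Dom (lambda I)) /\
    (forall mu alpha p, Dom p ->
       N mu alpha p = dy alpha (spray L v lambda mu) p).
Proof.
have /andP[_ dn] := hd.
(* The coordinate at [ord0] is left out, since [spray] accounts for it through [ell0] and [ell]. *)
exists (fun I => frame_coord v N (lift ord0 I)); split; last split.
- by move=> I; exact: (frame_coord_smooth dn hL hL0 hdet hv hN).
- by move=> I; exact: (frame_coord_homogeneous dn hL hL0 hdet hv hN).
move=> mu alpha p Dp; rewrite -(dy_potential hL hN)//; apply/esym.
(* The spray and the potential agree on the open set [Dom], hence so do their fibre derivatives. *)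
apply: (eq_derive_open (finsler_open hL)) Dp => q Dq.
exact: (spray_potential dn hL hL0 hdet hv hN).
Qed.
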